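(* Every unitarily antidiagonalizable complex matrix $M$ is unitarily similar to a direct sum of traceless, upper triangular $2\times2$ matrices, with an additional $1\times1$ matrix if $M$ is of odd size; explicitly, if $M$ is unitarily similar to the antidiagonal matrix $A$ with transpose pairs $\tau=\{\tau_1,\tau_2\}$, the direct sum is $$\bigoplus_{\tau}\begin{pmatrix}-\sqrt{\tau_1\tau_2}&(|\tau_2|-|\tau_1|)e^{\imath t_\tau}\\0&\sqrt{\tau_1\tau_2}\end{pmatrix}$$ over all transpose pairs on the antidiagonal of $A$ (for odd size, over those other than the one consisting of the center element $c$ of $A$, with the additional $1\times1$ summand $(c)$), for any choice of $t_\tau\in\mathbb R$. The multiset union, with additive multiplicities, of the spectra of the direct summands is equal to $\mathrm{spec}(M)$.
   Context: An antidiagonal matrix has nonzero entries only at positions $(i,n+1-i)$. $M$ is unitarily antidiagonalizable if $M=UAU^{-1}$ with $U$ unitary and $A$ antidiagonal. A transpose pair is a pair of indexed entries that are reflections of each other across the main diagonal (the center element of an odd-size matrix is paired with itself). $\sqrt{\tau_1\tau_2}$ is a complex square root of $\tau_1\tau_2$, $\imath=\sqrt{-1}$, and $\mathrm{spec}$ is the multiset of eigenvalues with algebraic multiplicity. *)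

(* Defs.v *)
From HB Require Import structures.
From mathcomp Require Import all_boot all_order all_algebra.
From mathcomp Require Import finmap multiset complex.
From mathcomp Require Import reals trigo.

Set Implicit Arguments.
Unset Strict Implicit.
Unset Printing Implicit Defensive.

Import Order.TTheory GRing.Theory Num.Theory.

Local Open Scope ring_scope.
Local Open Scope complex_scope.
Local Open Scope mset_scope.

(* [rev_ord i] is n + 1 - i in 1-based numbering. *)
Definition antidiagonal (R : realType) (n : nat) (A : 'M[R[i]]_n) : Prop :=
  forall i j : 'I_n, j != rev_ord i -> A i j = 0.

Definition unitarily_similar (R : realType) (n : nat) (M N : 'M[R[i]]_n) : Prop :=
  exists2 U : 'M[R[i]]_n, U \is unitarymx & M = U *m N *m invmx U.

Definition unitarily_antidiagonalizable (R : realType) (n : nat)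
    (M : 'M[R[i]]_n) : Prop :=
  exists2 A : 'M[R[i]]_n, antidiagonal A & unitarily_similar M A.

(* Eigenvalues with algebraic multiplicity: [closed_field_poly_normal] returns
   the list of all roots, each repeated according to its multiplicity. *)
Definition spec (R : realType) (n : nat) (M : 'M[R[i]]_n) : {mset R[i]} :=
  seq_mset (sval (closed_field_poly_normal (char_poly M))).

(* The pairs of mutually transposed antidiagonal positions other than the
   center, listed in some order, each pair with a chosen first member: [p k] is
   the row of that member, whose column is [rev_ord (p k)], so that the rows of
   the two members of the k-th pair are [p k] and [rev_ord (p k)]. *)
Definition transpose_pair_enum (n : nat) (p : 'I_n./2 -> 'I_n) : Prop :=
  (forall k, p k != rev_ord (p k)) /\
  (forall i : 'I_n, i != rev_ord i ->
     exists! k, i = p k \/ i = rev_ord (p k)).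

Definition tau1 (R : realType) (n : nat) (A : 'M[R[i]]_n)
    (p : 'I_n./2 -> 'I_n) (k : 'I_n./2) : R[i] := A (p k) (rev_ord (p k)).

Definition tau2 (R : realType) (n : nat) (A : 'M[R[i]]_n)
    (p : 'I_n./2 -> 'I_n) (k : 'I_n./2) : R[i] := A (rev_ord (p k)) (p k).

Definition cexpi (R : realType) (t : R) : R[i] := cos t +i* sin t.

(* [s] stands for the chosen square root of [a * b]. *)
Definition summand (R : realType) (a b s : R[i]) (t : R) : 'M[R[i]]_2 :=
  block_mx (- s)%:M ((`|b| - `|a|) * cexpi t)%:M
           0        s%:M
    :> 'M_(1 + 1).

Lemma direct_sum_size (n : nat) : (\sum_(k < n./2) 2 + odd n = n)%N.
Proof. by rewrite sum_nat_const card_ord muln2 addnC odd_double_half. Qed.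

Lemma center_lt (n : nat) (i : 'I_(odd n)) : (n./2 < n)%N.
Proof.
by case: n i => [[] //|n] i; rewrite ltn_half_double -addnn addSn ltnS leq_addl.
Qed.

(* Via the coercion from bool to nat this matrix is 1 x 1 when n is odd and
   0 x 0 (no extra summand) when n is even. *)
Definition center_block (R : realType) (n : nat) (A : 'M[R[i]]_n) : 'M[R[i]]_(odd n) :=
  \matrix_(i, j) A (Ordinal (center_lt i)) (Ordinal (center_lt j)).

Definition direct_sum (R : realType) (n : nat)
    (B : 'I_n./2 -> 'M[R[i]]_2) (D : 'M[R[i]]_(odd n)) : 'M[R[i]]_n :=
  castmx (direct_sum_size n, direct_sum_size n)
    (block_mx (\mxdiag_(k < n./2) B k) 0 0 D).

Definition spec_summands (R : realType) (n : nat)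
    (B : 'I_n./2 -> 'M[R[i]]_2) (D : 'M[R[i]]_(odd n)) : {mset R[i]} :=
  (\big[msetD/mset0]_(k < n./2) spec (B k)) `+` spec D.

(* Main.v *)
(* An antidiagonal matrix maps the plane spanned by the i-th and (n+1-i)-th
   basis vectors to itself, acting there by the matrix with rows (0, a), (b, 0),
   where a, b is a transpose pair. That matrix has the eigenvector
   (1, -s/a) for the eigenvalue -s, when s^2 = a b and a <> 0;
   completing it to an orthonormal basis gives a Schur form whose corner entry
   has modulus | |b| - |a| |, and rotating the second basis vector makes its
   phase arbitrary. *)
Require Import Defs.
From HB Require Import structures.
From mathcomp Require Import all_boot all_order all_algebra.
From mathcomp Require Import finmap multiset complex.
From mathcomp Require Import reals trigo.
From mathcomp Require Import ring zify.

Set Implicit Arguments.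
Unset Strict Implicit.
Unset Printing Implicit Defensive.

Import Order.TTheory GRing.Theory Num.Theory.

(** * Schur form of a two by two antidiagonal matrix *)

Local Open Scope ring_scope.
Local Open Scope sesquilinear_scope.

Lemma antidiagonal2_schur_vector (C : numClosedFieldType) (a b s e : C) :
  s ^+ 2 = a * b -> `|e| = 1 ->
  let x := (`|b| - `|a|) * e in
  exists u v g : C, [/\ u * u^* + v * v^* = 1, g * g^* = 1,
    a * v = - (s * u) /\ b * u = - (s * v),
    a * g * u^* = x * u - s * g * v^*
    & - (b * g * v^*) = x * v + s * g * u^* ].
Proof.
move=> s2 e1 x.
have ee : e * e^* = 1 by rewrite -normCK e1 expr1n.
have [a0|a_neq0] := eqVneq a 0.
  have s0 : s = 0 by apply/eqP; rewrite -sqrf_eq0 s2 a0 mul0r.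
  have [b0|b_neq0] := eqVneq b 0.
    exists 1, 0, 1; rewrite /x a0 b0 s0 normr0 conjC0 conjC1.
    by split; try split; ring.
  (* The kernel is spanned by the second basis vector, and [g] is forced by [- (b * g) = x], where
     [x] is now [|b| * e]. *)
  exists 0, 1, (- (`|b| * e / b)); rewrite /x a0 s0 normr0 conjC0 conjC1.
  split; try split; try ring; last by field.
  rewrite rmorphN rmorphM fmorphV rmorphM/= conj_normC mulrNN.
  have -> : `|b| * e / b * (`|b| * e^* / b^* ) = `|b| ^+ 2 * (e * e^* ) / (b * b^* ).
    by field; rewrite conjC_eq0 b_neq0.
  by rewrite ee mulr1 normCK divff// mulf_neq0 ?conjC_eq0.
pose al : C := `|a|; pose be : C := `|b|.
have al_gt0 : 0 < al by rewrite normr_gt0.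
have al0 : al != 0 by rewrite gt_eqF.
have be0 : 0 <= be by rewrite normr_ge0.
have ab_gt0 : 0 < al + be by rewrite ltr_wpDr.
have ab0 : al + be != 0 by rewrite gt_eqF.
have ac0 : a^* != 0 by rewrite conjC_eq0.
have aa : a * a^* = al ^+ 2 by rewrite normCK.
have ss : s * s^* = al * be by rewrite -normCK -normrX s2 normrM.
(* Normalizes [(1, - s / a)]: as [|s| ^+ 2 = al * be], its squared norm is [1 + be / al]. *)
pose r := sqrtC (al / (al + be)).
have r_ge0 : 0 <= r by rewrite sqrtC_ge0 divr_ge0// ltW.
have rc : r^* = r by apply: geC0_conj.
have rr : r ^+ 2 = al / (al + be) by rewrite sqrtCK.
(* The phase [g] is chosen so that [a * g = - (al * e)], which gives the corner entry the phase
   [e]. *)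
exists r, (- (s * r / a)), (- (a^* * e / al)).
have alc : al^* = al by rewrite conj_normC.
have -> : (- (s * r / a))^* = - (s^* * r / a^* ).
  by rewrite rmorphN rmorphM fmorphV rmorphM /= rc.
have -> : (- (a^* * e / al))^* = - (a * e^* / al).
  by rewrite rmorphN rmorphM fmorphV rmorphM /= conjCK alc.
rewrite rc.
split; last 2 first.
- rewrite /x -/al -/be.
  have -> : a * - (a^* * e / al) * r = - ((a * a^* ) * e * r / al) by field.
  have -> : (be - al) * e * r - s * - (a^* * e / al) * - (s^* * r / a^* ) =
     (be - al) * e * r - (s * s^* ) * e * r / al by field; rewrite ?al0 ?ac0.
  by rewrite aa ss; field.
- rewrite /x -/al -/be.
  have -> : - (b * - (a^* * e / al) * - (s^* * r / a^* )) =
    - (b * s^* * e * r / al) by field; rewrite ?al0 ?ac0.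
  (* For nonzero [s] this is checked after multiplying by [s], where [s * s^*] and [s ^+ 2] are both
     known. *)
  have -> : b * s^* = s * be * al / a.
    have [s0|s_neq0] := eqVneq s 0; first by rewrite s0 conjC0; ring.
    apply: (mulfI s_neq0); rewrite mulrCA ss.
    have -> : s * (s * be * al / a) = s ^+ 2 * be * al / a by ring.
    by rewrite s2; field.
  have -> : s * - (a^* * e / al) * r = - (s * (a * a^* ) * e * r / al / a).
    by field; rewrite ?al0 ?a_neq0.
  by rewrite aa; field; rewrite ?al0 ?a_neq0.
- have -> : r * r + - (s * r / a) * - (s^* * r / a^* ) =
     r ^+ 2 * (1 + s * s^* / (a * a^* )) by field; rewrite ?a_neq0 ?ac0.
  by rewrite rr ss aa; field; rewrite ?al0 ?ab0.
- have -> : - (a^* * e / al) * - (a * e^* / al) =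
    (a * a^* ) * (e * e^* ) / al ^+ 2 by field.
  by rewrite aa ee mulr1 divff// expf_neq0.
- split; first by field.
  have -> : - (s * - (s * r / a)) = s ^+ 2 * r / a by field.
  by rewrite s2; field.
Qed.

(** The [1 + 1] block form matches that of [summand], so products are computed blockwise. *)
Definition antidiag2 (C : pzRingType) (a b : C) : 'M[C]_2 :=
  block_mx 0 a%:M b%:M 0 :> 'M_(1 + 1).

Lemma antidiag2E (C : pzRingType) (a b : C) (i j : 'I_2) :
  antidiag2 a b i j = if i == j then 0 else if i == 0 then a else b.
Proof.
rewrite /antidiag2 !mxE; case: splitP => i' ei; rewrite !mxE; case: splitP => j' ej;
  by rewrite !mxE -!val_eqE /= ei ej !ord1.
Qed.

Lemma antidiagonal2_schur (C : numClosedFieldType) (a b s e : C) :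
  s ^+ 2 = a * b -> `|e| = 1 -> let x := (`|b| - `|a|) * e in
  exists Q : 'M[C]_2, Q^t* *m Q = 1%:M /\
    antidiag2 a b *m Q =
    Q *m (block_mx (- s)%:M x%:M 0 s%:M :> 'M_(1 + 1)).
Proof.
move=> s2 e1 x; have [u [v [g [uv gg [av bu] hx hy]]]] :=
  antidiagonal2_schur_vector s2 e1.
(* The sizes [2] and [1 + 1] are convertible; the latter lets the block lemmas apply. *)
suff: exists Q : 'M[C]_(1 + 1), Q^t* *m Q = 1%:M /\
  block_mx 0 a%:M b%:M 0 *m Q = Q *m block_mx (- s)%:M x%:M 0 s%:M by [].
exists (block_mx u%:M (- (g * v^* ))%:M v%:M (g * u^* )%:M); split.
  rewrite tr_block_mx !tr_scalar_mx map_block_mx !map_scalar_mx/= mulmx_block.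
  rewrite -!scalar_mxM -!raddfD/= scalar_mx_block.
  have -> : (- (g * v^* ))^* = - (g^* * v) by rewrite rmorphN rmorphM /= conjCK.
  have -> : (g * u^* )^* = g^* * u by rewrite rmorphM /= conjCK.
  congr (block_mx _ _ _ _).
  - by rewrite -uv; congr (_%:M); ring.
  - by rewrite -[RHS](raddf0 scalar_mx); congr (_%:M); ring.
  - by rewrite -[RHS](raddf0 scalar_mx); congr (_%:M); ring.
  - by rewrite -[1](mulr1 1) -{1}gg -uv; congr (_%:M); ring.
rewrite !mulmx_block !mul0mx !mulmx0 ?add0r ?addr0 -!scalar_mxM -!raddfD/=.
congr (block_mx _%:M _%:M _%:M _%:M).
- by rewrite av; ring.
- by rewrite mulrA hx /x; ring.
- by rewrite bu; ring.
- have -> : b * - (g * v^* ) = - (b * g * v^* ) by ring.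
  by rewrite hy /x; ring.
Qed.

(** * Spectra as multisets: similarity invariance and additivity over blocks *)

Local Open Scope complex_scope.

Lemma seq_mset_cat (K : choiceType) (r s : seq K) :
  seq_mset (r ++ s) = (seq_mset r `+` seq_mset s)%mset.
Proof. by apply/msetP => x; rewrite msetE2 !mset_seqE count_cat. Qed.

(** The scalar matrix ['X%:M] commutes with the conjugation, so the whole characteristic matrix is
    conjugated and its determinant is unchanged. *)
Lemma char_poly_similar (F : fieldType) (n : nat) (P A : 'M[F]_n) :
  P \in unitmx -> char_poly (P *m A *m invmx P) = char_poly A.
Proof.
move=> Pu; rewrite /char_poly /char_poly_mx !map_mxM.
set P' := map_mx _ P; set Q' := map_mx _ (invmx P).
have PQ : P' *m Q' = 1%:M by rewrite -map_mxM mulmxV// map_mx1.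
rewrite [in LHS](_ : 'X%:M = P' *m 'X%:M *m Q'); last first.
  by rewrite scalar_mxC -mulmxA PQ mulmx1.
by rewrite -mulmxBl -mulmxBr !det_mulmx mulrAC -det_mulmx PQ det1 mul1r.
Qed.

Section Spectrum.
Variable R : realType.

Lemma char_poly_spec (n : nat) (M : 'M[R[i]]_n) :
  char_poly M = \prod_(x <- spec M) ('X - x%:P).
Proof.
rewrite (perm_big _ (perm_eq_seq_mset _)); case: closed_field_poly_normal => r /=.
by rewrite (monicP (char_poly_monic M)) scale1r.
Qed.

(** Unique factorization makes the multiset independent of the root list chosen in [spec], so
    spectra can be read off any splitting of the characteristic polynomial. *)
Lemma spec_char_poly (n : nat) (M : 'M[R[i]]_n) (r : seq R[i]) :
  char_poly M = \prod_(x <- r) ('X - x%:P) -> spec M = seq_mset r.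
Proof.
rewrite char_poly_spec => /prod_XsubC_eq r_spec.
by rewrite -[LHS]seq_mset_id; apply/eq_seq_msetP.
Qed.

Lemma spec_unitarily_similar (n : nat) (M N : 'M[R[i]]_n) :
  unitarily_similar M N -> spec M = spec N.
Proof.
move=> [U U_unitary ->]; rewrite -[RHS]seq_mset_id.
by apply: spec_char_poly; rewrite char_poly_similar ?unitarymx_unit// char_poly_spec.
Qed.

Lemma spec_block_diag (m n : nat) (A : 'M[R[i]]_m) (B : 'M[R[i]]_n) :
  spec (block_mx A 0 0 B) = (spec A `+` spec B)%mset.
Proof.
rewrite -[spec A]seq_mset_id -[spec B]seq_mset_id -seq_mset_cat.
apply: spec_char_poly; rewrite /char_poly char_block_diag_mx det_ublock.
by rewrite big_cat /= -!char_poly_spec.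
Qed.

Lemma spec_castmx (m n : nat) (e : m = n) (A : 'M[R[i]]_m) :
  spec (castmx (e, e) A) = spec A.
Proof. by case: n / e; rewrite castmx_id. Qed.

Lemma spec_mx0 (n : nat) (A : 'M[R[i]]_n) : n = 0 -> spec A = mset0.
Proof.
move=> n0; subst n; have -> : spec A = seq_mset [::].
  by apply: spec_char_poly; rewrite big_nil /char_poly det_mx00.
by apply/msetP => x; rewrite mset0E mset_seqE.
Qed.

Lemma spec_mxdiag (m : nat) (d : 'I_m -> nat) (B : forall k, 'M[R[i]]_(d k)) :
  spec (\mxdiag_k B k) = \big[msetD/mset0]_k spec (B k).
Proof.
elim: m d B => [|m IHm] d B; first by rewrite [RHS]big_ord0 spec_mx0 ?big_ord0.
by rewrite mxdiag_recl spec_castmx spec_block_diag IHm big_ord_recl.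
Qed.

Lemma spec_direct_sum (n : nat) (B : 'I_n./2 -> 'M[R[i]]_2)
    (D : 'M[R[i]]_(odd n)) :
  spec (direct_sum B D) = spec_summands B D.
Proof. by rewrite spec_castmx spec_block_diag spec_mxdiag. Qed.

End Spectrum.

Lemma norm_cexpi (R : realType) (t : R) : `|cexpi t| = 1.
Proof. by rewrite normc_def /= cos2Dsin2 sqrtr1. Qed.

Lemma unitarily_similar_trans (R : realType) (n : nat) (L M N : 'M[R[i]]_n) :
  unitarily_similar L M -> unitarily_similar M N -> unitarily_similar L N.
Proof.
move=> [U Uu ->] [V Vu ->]; exists (U *m V); first exact: mul_unitarymx.
by rewrite !invmx_unitary ?mul_unitarymx// trmx_mul map_mxM !mulmxA.
Qed.

(** An isometry between spaces of equal dimension is unitary. Letting [V] have formally different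
    sizes confines the cast to the conclusion. *)
Lemma unitarily_similar_intertwine (R : realType) (m n : nat) (e : m = n)
    (A : 'M[R[i]]_n) (T : 'M[R[i]]_m) (V : 'M[R[i]]_(n, m)) :
  V^t* *m V = 1%:M -> A *m V = V *m T -> unitarily_similar A (castmx (e, e) T).
Proof.
case: n / e A V => A V V1 AV; rewrite castmx_id.
have Vu : V \is unitarymx by apply/unitarymxP; exact: mulmx1C.
by exists V => //; rewrite -AV mulmxK ?unitarymx_unit.
Qed.

Lemma map_mxcol (aT rT : Type) (f : aT -> rT) (m n : nat) (d : 'I_m -> nat)
    (B : forall k, 'M[aT]_(d k, n)) :
  map_mx f (\mxcol_k B k) = \mxcol_k map_mx f (B k).
Proof. by apply/matrixP => i j; rewrite !mxE. Qed.

(** * Splitting the space into the planes of the transpose pairs and the center line *)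

Section DirectSum.
Variables (R : realType) (n : nat) (A : 'M[R[i]]_n) (p : 'I_n./2 -> 'I_n).
Hypotheses (A_anti : antidiagonal A) (p_enum : transpose_pair_enum p).

Let pair_row (k : 'I_n./2) (j : 'I_(1 + 1)) : 'I_n :=
  if j == 0 then p k else rev_ord (p k).
Let center_row (i : 'I_(odd n)) : 'I_n := Ordinal (center_lt i).

Lemma rev_center (i : 'I_(odd n)) : rev_ord (center_row i) = center_row i.
Proof.
(* The mere existence of [i] in ['I_(odd n)] forces [n] to be odd. *)
have n_odd : odd n by have := leq_ltn_trans (leq0n i) (ltn_ord i); case: odd.
apply: val_inj; rewrite /= -[X in (X - _)%N]odd_double_half n_odd.
by rewrite add1n subSS -addnn addnK.
Qed.

Lemma rev_pair_neq (k : 'I_n./2) (j : 'I_(1 + 1)) :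
  pair_row k j != rev_ord (pair_row k j).
Proof.
rewrite /pair_row; case: ifP => _; first exact: p_enum.1.
by rewrite rev_ordK eq_sym; exact: p_enum.1.
Qed.

(** Uniqueness in [transpose_pair_enum] identifies the pair, and its two rows differ. This gives the
    orthonormality of the basis vectors selected by the pairs. *)
Lemma pair_row_eq (k l : 'I_n./2) (i j : 'I_(1 + 1)) :
  (pair_row k i == pair_row l j) = (k == l) && (i == j).
Proof.
apply/eqP/andP => [kl|[/eqP-> /eqP->]//].
have [m [_ m_uniq]] := p_enum.2 _ (rev_pair_neq k i).
have ek : m = k by apply: m_uniq; rewrite /pair_row; case: ifP; [left|right].
have el : m = l by apply: m_uniq; rewrite kl /pair_row; case: ifP; [left|right].
rewrite -ek -el eqxx; split=> //; move: kl; rewrite -ek -el /pair_row.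
have /eqP := p_enum.1 m; case: i j {ek el m_uniq} => [[|[|//]] ?] [[|[|//]] ?] //=.
by move=> p_rev E; case: p_rev.
Qed.

Lemma pair_center_neq (k : 'I_n./2) (j : 'I_(1 + 1)) (i : 'I_(odd n)) :
  (pair_row k j == center_row i) = false.
Proof.
by apply/negP => /eqP E; have := rev_pair_neq k j; rewrite E rev_center eqxx.
Qed.

(** Inner products of standard basis vectors are entries of the identity, so orthogonality reduces
    to comparing indices. *)
Lemma adjoint_mul_colsub1 (C : numClosedFieldType) (m l1 l2 : nat)
    (f : 'I_l1 -> 'I_m) (g : 'I_l2 -> 'I_m) :
  (colsub f 1%:M)^t* *m colsub g 1%:M = mxsub f g 1%:M :> 'M[C]_(l1, l2).
Proof. by rewrite trmx_mxsub trmx1 map_mxsub map_mx1 -mxsub_mul mulmx1. Qed.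

Let pair_mx k : 'M[R[i]]_(n, 2) := colsub (pair_row k) 1%:M.
Let center_mx : 'M[R[i]]_(n, odd n) := colsub center_row 1%:M.

Lemma mul_pair_mx (k : 'I_n./2) :
  A *m pair_mx k =
  pair_mx k *m antidiag2 (tau1 A p k) (tau2 A p k).
Proof.
rewrite mulmx_colsub mulmx1; apply/matrixP => i j; rewrite mxE [RHS]mxE.
rewrite big_ord_recl big_ord1 !antidiag2E /pair_mx !mxE /pair_row /=.
(* Column [r] of an antidiagonal matrix is supported on the single row [rev_ord r]. *)
have A_col r : A i r = (i == rev_ord r)%:R * A (rev_ord r) r.
  have [->|i_neq] := eqVneq i (rev_ord r); first by rewrite mul1r.
  by rewrite mul0r A_anti// -(inj_eq rev_ord_inj) rev_ordK eq_sym.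
case: j => [[|[|//]] j_lt] /=.
- by rewrite A_col /= mulr0 add0r.
- by rewrite A_col rev_ordK /= mulr0 addr0.
Qed.

Lemma mul_center_mx : A *m center_mx = center_mx *m center_block A.
Proof.
rewrite mulmx_colsub mulmx1; apply/matrixP => i j; rewrite !mxE.
(* The index type has at most one element, so the sum has one term. *)
have j_only (l : 'I_(odd n)) : l = j.
  by apply: val_inj; case: odd l j => [[[|//] ?] [[|//] ?]|[]].
rewrite (bigD1 j)//= big1 ?addr0 => [|l /eqP[]//]; rewrite !mxE.
have [->|i_neq] := eqVneq i (center_row j); first by rewrite mul1r.
by rewrite mul0r A_anti// -rev_center (inj_eq rev_ord_inj) eq_sym.
Qed.

Lemma antidiagonal_direct_sum (B : 'I_n./2 -> 'M[R[i]]_2) :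
  (forall k, exists Q : 'M[R[i]]_2, Q^t* *m Q = 1%:M /\
     antidiag2 (tau1 A p k) (tau2 A p k) *m Q = Q *m B k) ->
  unitarily_similar A (direct_sum B (center_block A)).
Proof.
move=> /fin_all_exists[Q QP].
(* The columns are the local Schur bases, carried into the planes of the pairs, followed by the
   center vector. Intertwining is checked plane by plane, and [V^t* *m V] block by block. *)
pose V := row_mx (\mxrow_k (pair_mx k *m Q k)) center_mx.
apply: (@unitarily_similar_intertwine _ _ _ _ A _ V); last first.
  rewrite mul_mx_row mul_mxrow mul_center_mx mul_row_block !mulmx0 addr0 add0r.
  rewrite mul_mxrow_mxdiag; congr row_mx; apply: eq_mxrow => k.
  by rewrite mulmxA mul_pair_mx -!mulmxA (QP k).2.
rewrite tr_row_mx map_col_mx mul_col_row scalar_mx_block.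
congr block_mx.
- rewrite tr_mxrow map_mxcol mul_mxcol_mxrow -mxdiagZ; apply: eq_mxblock => k l.
  rewrite trmx_mul map_mxM -mulmxA (mulmxA _ (pair_mx l)) adjoint_mul_colsub1.
  have [<-|kl] := eqVneq k l; rewrite ?conform_mx_id.
    rewrite (_ : mxsub _ _ _ = 1%:M) ?mul1mx ?(QP k).1//.
    by apply/matrixP => i j; rewrite !mxE pair_row_eq eqxx.
  rewrite (_ : mxsub _ _ _ = 0) ?mul0mx ?mulmx0//.
  by apply/matrixP => i j; rewrite !mxE pair_row_eq (negPf kl).
- rewrite tr_mxrow map_mxcol mxcol_mul -mxcol0; apply: eq_mxcol => k.
  rewrite trmx_mul map_mxM -mulmxA adjoint_mul_colsub1.
  rewrite (_ : mxsub _ _ _ = 0) ?mulmx0//.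
  by apply/matrixP => i j; rewrite !mxE pair_center_neq.
- rewrite mul_mxrow -mxrow0; apply: eq_mxrow => k.
  rewrite mulmxA adjoint_mul_colsub1 (_ : mxsub _ _ _ = 0) ?mul0mx//.
  by apply/matrixP => i j; rewrite !mxE eq_sym pair_center_neq.
- rewrite adjoint_mul_colsub1; apply/matrixP => i j; rewrite !mxE.
  by rewrite -val_eqE /= eqxx; case: odd i j => [[[|//] ?] [[|//] ?]|[]].
Qed.

End DirectSum.

(** * The explicit direct sum and the final statement *)

Lemma antidiagonal_summands (R : realType) (n : nat) (M A : 'M[R[i]]_n) :
  antidiagonal A -> unitarily_similar M A ->
  forall p : 'I_n./2 -> 'I_n, transpose_pair_enum p ->
  forall s : 'I_n./2 -> R[i], (forall k, s k ^+ 2 = tau1 A p k * tau2 A p k) ->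
  forall t : 'I_n./2 -> R,
    let B k := summand (tau1 A p k) (tau2 A p k) (s k) (t k) in
    unitarily_similar M (direct_sum B (center_block A)) /\
    spec_summands B (center_block A) = spec M.
Proof.
move=> A_anti MA p p_enum s s2 t B.
have MB : unitarily_similar M (direct_sum B (center_block A)).
  apply: unitarily_similar_trans MA _.
  apply: (antidiagonal_direct_sum A_anti p_enum) => k.
  exact: antidiagonal2_schur (s2 k) (norm_cexpi (t k)).
by split; rewrite // (spec_unitarily_similar MB) spec_direct_sum.
Qed.

Lemma transpose_pair_enum_exists (n : nat) :
  exists p : 'I_n./2 -> 'I_n, transpose_pair_enum p.
Proof.
have half_le : (n./2 <= n)%N by lia.
(* The rows strictly above the center represent the pairs; a row strictly below it is the reflection
   of exactly one of them. *)
exists (widen_ord half_le); split=> [k|i].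
  by apply/eqP => /(congr1 val) /=; have := ltn_ord k; lia.
move=> /eqP i_neq; have {}i_neq : (i <> n - i.+1 :> nat)%N.
  by move=> E; apply: i_neq; apply: val_inj.
have i_lt := ltn_ord i.
have [i_half|i_half] := ltnP i n./2.
  exists (Ordinal i_half); split; first by left; apply: val_inj.
  move=> k; have := ltn_ord k.
  by move=> k_lt [] /(congr1 val) /= E; apply: val_inj => /=; lia.
have ri_half : (n - i.+1 < n./2)%N by lia.
exists (Ordinal ri_half); split; first by right; apply: val_inj => /=; lia.
move=> k; have := ltn_ord k.
by move=> k_lt [] /(congr1 val) /= E; apply: val_inj => /=; lia.
Qed.

Theorem corollary6p5 (R : realType) (n : nat) (M : 'M[R[i]]_n)
    (hM : unitarily_antidiagonalizable M) :
  (exists (B : 'I_n./2 -> 'M[R[i]]_2) (D : 'M[R[i]]_(odd n)),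
     [/\ forall k, \tr (B k) = 0,
         forall k (i j : 'I_2), (j < i)%N -> B k i j = 0,
         unitarily_similar M (direct_sum B D)
       & spec_summands B D = spec M]) /\
  (forall A : 'M[R[i]]_n, antidiagonal A -> unitarily_similar M A ->
   forall p : 'I_n./2 -> 'I_n, transpose_pair_enum p ->
   forall s : 'I_n./2 -> R[i], (forall k, s k ^+ 2 = tau1 A p k * tau2 A p k) ->
   forall t : 'I_n./2 -> R,
     let B k := summand (tau1 A p k) (tau2 A p k) (s k) (t k) in
     unitarily_similar M (direct_sum B (center_block A)) /\
     spec_summands B (center_block A) = spec M).
Proof.
split; last by move=> A A_anti MA; exact: antidiagonal_summands.
have [A A_anti MA] := hM.
have [p p_enum] := transpose_pair_enum_exists n.
(* For bare existence any root and any phase will do: here [sqrtC] and [t = 0]. *)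
pose s k := sqrtC (tau1 A p k * tau2 A p k).
have s2 k : s k ^+ 2 = tau1 A p k * tau2 A p k by rewrite sqrtCK.
have [MB specB] := antidiagonal_summands A_anti MA p_enum s2 (fun=> 0).
exists (fun k => summand (tau1 A p k) (tau2 A p k) (s k) 0), (center_block A).
split=> // [k|k i j].
  by rewrite [LHS](@mxtrace_block _ 1 1) !mxtrace_scalar addNr.
(* Only the position in row 1, column 0 survives [j < i]; it is the lower left block of
   [summand]. *)
case: i => [[|[|//]] i_lt]; case: j => [[|[|//]] j_lt] //= _.
have -> : Ordinal i_lt = rshift 1 (ord0 : 'I_1) by apply: val_inj.
have -> : Ordinal j_lt = lshift 1 (ord0 : 'I_1) by apply: val_inj.
by rewrite [LHS](@block_mxEdl _ 1 1 1 1) mxE.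
Qed.
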